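(* For any VarianceReduction algorithm (possibly using shared randomness) in which any machine receives at most $b$ bits in expectation, there is a valid input distribution for which $\mathbb{E}[\|\mathbf{EST}-\boldsymbol\nabla\|^2]=\Omega\!\left(\sigma^2\,2^{-3b/d}\right)$.
   Context: VarianceReduction: there are $n$ machines and an unknown true vector $\boldsymbol\nabla\in\mathbb{R}^d$. Each machine $v$ receives an independent random input $\mathbf{x}_v$ with $\mathbb{E}[\mathbf{x}_v]=\boldsymbol\nabla$ and $\mathbb{E}[\|\mathbf{x}_v-\boldsymbol\nabla\|^2]\le\sigma^2$, $\sigma$ known. All machines must output the same $\mathbf{EST}\in\mathbb{R}^d$ with $\mathbb{E}[\mathbf{EST}]=\boldsymbol\nabla$. $\|\cdot\|$ is a fixed one of the $\ell_1,\ell_2,\ell_\infty$ norms. Algorithms may use a common random string. Bits received by a machine count all bits it receives from any source. The hidden constant is absolute. *)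

(* Defs.v *)
From HB Require Import structures.
From mathcomp Require Import all_boot all_order all_algebra.
From mathcomp Require Import all_classical all_reals all_analysis.
Set Implicit Arguments. Unset Strict Implicit. Unset Printing Implicit Defensive.
Import Order.TTheory GRing.Theory Num.Theory.
Local Open Scope classical_set_scope.
Local Open Scope ring_scope.

Inductive norm_kind := L1 | L2 | Linf.

Definition vnorm {R : realType} {d : nat} (k : norm_kind) (x : 'rV[R]_d) : R :=
  match k with
  | L1 => \sum_(i < d) `|x ord0 i|
  | L2 => Num.sqrt (\sum_(i < d) (x ord0 i) ^+ 2)
  | Linf => \big[Num.max/0]_(i < d) `|x ord0 i|
  end.

(* Inputs: X w is an n x d matrix whose row v is the input x_v of machine v. *)

Definition gen_row {dT} {T : measurableType dT} {R : realType} {n d : nat}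
    (X : T -> 'M[R]_(n, d)) (v : 'I_n) : set (set T) :=
  <<s [set A | exists i : 'I_d, exists B : set R,
                 measurable B /\ A = (fun w => X w v i) @^-1` B] >>.

Definition gen_rand {dT dU} {T : measurableType dT} {U : measurableType dU}
    (S : T -> U) : set (set T) :=
  [set A | exists B : set U, measurable B /\ A = S @^-1` B].

Definition mutually_indep {dT dU} {T : measurableType dT} {U : measurableType dU}
    {R : realType} {n d : nat} (P : probability T R)
    (X : T -> 'M[R]_(n, d)) (S : T -> U) : Prop :=
  let F (j : option 'I_n) : set (set T) :=
      match j with Some v => gen_row X v | None => gen_rand S end in
  forall A : option 'I_n -> set T, (forall j, F j (A j)) ->
    fine (P (\bigcap_j A j)) = \prod_(j : option 'I_n) fine (P (A j)).

Definition has_law {dT dU} {T : measurableType dT} {U : measurableType dU}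
    {R : realType} (P : probability T R) (S : T -> U) (rho : probability U R) : Prop :=
  measurable_fun setT S /\ forall B, measurable B -> P (S @^-1` B) = rho B.

Definition valid_input {dT} {T : measurableType dT} {R : realType} {n d : nat}
    (k : norm_kind) (sigma : R) (P : probability T R)
    (X : T -> 'M[R]_(n, d)) (grad : 'rV[R]_d) : Prop :=
  (forall v i, measurable_fun setT (fun w => X w v i)) /\
  (forall v i, P.-integrable setT (fun w => (X w v i)%:E) /\
               (\int[P]_w (X w v i)%:E = (grad ord0 i)%:E)%E) /\
  (forall v, (\int[P]_w ((vnorm k (row v (X w) - grad)) ^+ 2)%:E
               <= (sigma ^+ 2)%:E)%E).

(* Output of machine v: a function of its own input, the shared randomness u
   and the bit string it received, g v u x (which may depend on everything). *)
Definition out {R : realType} {U : Type} {n d : nat}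
    (g : 'I_n -> U -> 'M[R]_(n, d) -> seq bool)
    (f : 'I_n -> 'rV[R]_d -> U -> seq bool -> 'rV[R]_d)
    (v : 'I_n) (u : U) (x : 'M[R]_(n, d)) : 'rV[R]_d :=
  f v (row v x) u (g v u x).

(* A VarianceReduction algorithm (shared randomness of law rho, received
   bit strings g, local output maps f) that is correct (unbiased, all
   machines agree) and in which every machine receives at most b bits in
   expectation, on every valid input. *)
Definition VR_algorithm {R : realType} {dU} {U : measurableType dU} {n d : nat}
    (k : norm_kind) (sigma b : R) (rho : probability U R)
    (g : 'I_n -> U -> 'M[R]_(n, d) -> seq bool)
    (f : 'I_n -> 'rV[R]_d -> U -> seq bool -> 'rV[R]_d) : Prop :=
  (forall v w u x, out g f v u x = out g f w u x) /\
  forall (grad : 'rV[R]_d) dT (T : measurableType dT) (P : probability T R)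
         (X : T -> 'M[R]_(n, d)) (S : T -> U),
    valid_input k sigma P X grad -> mutually_indep P X S -> has_law P S rho ->
    (forall v i, measurable_fun setT (fun w => out g f v (S w) (X w) ord0 i)) /\
    (forall v, measurable_fun setT (fun w => ((size (g v (S w) (X w)))%:R : R))) /\
    (forall v i, P.-integrable setT (fun w => (out g f v (S w) (X w) ord0 i)%:E) /\
                 (\int[P]_w (out g f v (S w) (X w) ord0 i)%:E = (grad ord0 i)%:E)%E) /\
    (forall v, (\int[P]_w ((size (g v (S w) (X w)))%:R%:E) <= b%:E)%E).

(* Main.v *)
(* One machine is shown 0 with probability 9/10, and 10 grad otherwise, while
   all other inputs equal grad, so that 9/10 of the time it can only learn grad
   from the bits it receives.  By Markov it then receives at most 3b/2 bits with
   positive probability, hence for a fixed random string its output takes at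
   most 2^(3b/2 + 1) values.  If grad ranges over the lattice points of a ball
   of radius sigma/3, these values lie within r = Theta(sigma 2^(-3b/2d)) of only
   a small fraction of the candidates, so averaging over them yields one grad
   missed by r with constant probability. *)
Require Import Defs.
From HB Require Import structures.
From mathcomp Require Import all_boot all_order all_algebra.
From mathcomp Require Import all_classical all_reals all_analysis.
From mathcomp Require Import measurable_realfun ring lra.
Import Order.TTheory GRing.Theory Num.Theory.
Local Open Scope classical_set_scope.
Local Open Scope ring_scope.

(** * Squared norms: inequalities shared by the three norms *)

Section vnorm_sqr.
Context {R : realType} {d : nat}.
Implicit Types (k : norm_kind) (x y : 'rV[R]_d).

Lemma vnorm_ge0 k x : 0 <= vnorm k x.
Proof.
case: k => /=; first exact: sumr_ge0; first exact: sqrtr_ge0.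
exact: bigmax_ge_id.
Qed.

Lemma vnorm2_sqr x : vnorm L2 x ^+ 2 = \sum_(i < d) x ord0 i ^+ 2.
Proof. by rewrite sqr_sqrtr// sumr_ge0// => i _; exact: sqr_ge0. Qed.

(** The scalar bound (a + b)^2 <= 2 a^2 + 2 b^2 is applied to the norms after the triangle
    inequality for [L1] and [Linf], and coordinate by coordinate for [L2]. *)
Lemma vnormD_sqr k x y :
  vnorm k (x + y) ^+ 2 <= 2 * vnorm k x ^+ 2 + 2 * vnorm k y ^+ 2.
Proof.
have sqrD (a b : R) : (a + b) ^+ 2 <= 2 * a ^+ 2 + 2 * b ^+ 2.
  rewrite -subr_ge0 (_ : _ - _ = (a - b) ^+ 2) ?sqr_ge0//; ring.
have tri : vnorm k (x + y) <= vnorm k x + vnorm k y ->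
    vnorm k (x + y) ^+ 2 <= 2 * vnorm k x ^+ 2 + 2 * vnorm k y ^+ 2.
  move=> h; apply: le_trans (sqrD _ _).
  by rewrite ler_pXn2r// nnegrE ?addr_ge0// vnorm_ge0.
case: k tri => tri.
- apply: tri => /=; rewrite -big_split ler_sum// => i _.
  by rewrite mxE ler_normD.
- rewrite !vnorm2_sqr !mulr_sumr -big_split ler_sum// => i _.
  by rewrite mxE sqrD.
- apply: tri => /=; apply/bigmax_leP; split=> [|i _].
    by rewrite addr_ge0// bigmax_ge_id.
  by rewrite mxE (le_trans (ler_normD _ _))// lerD//;
    exact: (le_bigmax _ (fun i => `|_ ord0 i|) i).
Qed.

Lemma vnormZ_sqr k (a : R) x : vnorm k (a *: x) ^+ 2 = a ^+ 2 * vnorm k x ^+ 2.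
Proof.
case: k.
- rewrite /= -[a ^+ 2](real_normK (num_real _)) -exprMn mulr_sumr.
  by congr (_ ^+ 2); apply: eq_bigr => i _; rewrite mxE normrM.
- by rewrite !vnorm2_sqr mulr_sumr; apply: eq_bigr => i _; rewrite mxE exprMn.
- rewrite /= -[a ^+ 2](real_normK (num_real _)) -exprMn; congr (_ ^+ 2).
  elim/big_ind2: _ => [|u1 u2 v1 v2 -> ->|i _]; first by rewrite mulr0.
    by rewrite -maxr_pMr.
  by rewrite mxE normrM.
Qed.

(** The l1 norm is the largest of the three; this bounds the offsets that fill the gaps of a
    blown-up lattice ball, for all norms at once. *)
Lemma vnorm_sqr_le_sum k x : vnorm k x ^+ 2 <= (\sum_(i < d) `|x ord0 i|) ^+ 2.
Proof.
have le1 i : `|x ord0 i| <= \sum_(i < d) `|x ord0 i|.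
  by rewrite (bigD1 i)//= lerDl sumr_ge0.
case: k => //.
- rewrite vnorm2_sqr expr2 mulr_suml ler_sum// => i _.
  by rewrite -real_normK ?num_real// expr2 ler_wpM2l.
- rewrite ler_pXn2r ?nnegrE ?vnorm_ge0 ?sumr_ge0//=.
  by apply/bigmax_leP; split=> [|i _]; [exact: sumr_ge0|exact: le1].
Qed.

Lemma coord_sqr_le_vnorm k x i : x ord0 i ^+ 2 <= vnorm k x ^+ 2.
Proof.
rewrite -[x ord0 i ^+ 2](real_normK (num_real _)); case: k.
- rewrite ler_pXn2r ?nnegrE ?vnorm_ge0//=.
  by rewrite (bigD1 i)//= lerDl sumr_ge0.
- rewrite vnorm2_sqr real_normK ?num_real// (bigD1 i)//= lerDl sumr_ge0// => *.
  exact: sqr_ge0.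
- rewrite ler_pXn2r ?nnegrE ?vnorm_ge0//=.
  exact: (le_bigmax _ (fun i => `|x ord0 i|) i).
Qed.

Lemma measurable_vnorm_sqr {dT} {T : measurableType dT} k (F : T -> 'rV[R]_d) :
  (forall i, measurable_fun setT (fun w => F w ord0 i)) ->
  measurable_fun setT (fun w => vnorm k (F w) ^+ 2).
Proof.
move=> mF; case: k.
- apply: measurable_funX; apply: measurable_sum => i.
  exact: measurableT_comp.
- under eq_fun do rewrite vnorm2_sqr.
  by apply: measurable_sum => i; exact: measurable_funX.
- apply: measurable_funX => /=.
  elim: (index_enum _) => [|i s ih].
    by under eq_fun do rewrite big_nil; exact: measurable_cst.
  under eq_fun do rewrite big_cons.
  by apply: measurable_maxr => //; exact: measurableT_comp.
Qed.

End vnorm_sqr.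

(** * Counting lattice points in balls *)

Section lattice_ball.
Context {R : realType}.
Variables (k : norm_kind) (d m : nat).

Local Notation box := {ffun 'I_d -> 'I_(4 * m * d).+1}.

(** The shift by 2md centres the box [0, 4md]^d at the origin. No coordinate exceeds the norm, so
    the box holds every integer vector of norm at most 2md. *)
Definition lattice_point (z : box) : 'rV[R]_d :=
  \row_i ((z i)%:R - (2 * m * d)%:R).

Definition lattice_ball : {set box} :=
  finset (fun z => vnorm k (lattice_point z) ^+ 2 <= (2 * m * d)%:R ^+ 2).

(** The radius is d/2: two near points differ by at most d, and by md after blowing up, which is the
    scale of the l1 norm of an offset in [0, m)^d. *)
Definition lattice_near (y : 'rV[R]_d) : {set box} :=
  finset (fun z => (z \in lattice_ball) &&
           (4 * vnorm k (lattice_point z - y) ^+ 2 < d%:R ^+ 2)).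

Lemma lattice_ball_gt0 : (0 < #|lattice_ball|)%N.
Proof.
have h : (2 * m * d < (4 * m * d).+1)%N.
  by rewrite ltnS -!mulnA leq_mul.
apply/card_gt0P; exists [ffun=> Ordinal h]; rewrite inE.
rewrite (_ : lattice_point _ = 0 *: 0); last first.
  by apply/rowP => i; rewrite !mxE ffunE /= subrr mulr0.
by rewrite vnormZ_sqr expr0n mul0r sqr_ge0.
Qed.

(* Blowing up a small ball by the factor m and filling the gaps with the
   offsets e in [0, m)^d stays within the large ball: this is the lattice
   version of vol(m B) = m^d vol(B). *)
Lemma card_lattice_near y : (#|lattice_near y| * m ^ d <= #|lattice_ball|)%N.
Proof.
(* A near point [z0] replaces [y] as centre of the blow-up, so that images stay integral. *)
have [->|[z0 z0y]] := set_0Vmem (lattice_near y); first by rewrite cards0.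
pose boxm := (box * {ffun 'I_d -> 'I_m})%type.
(* Coordinate of m (z - z0) + e, moved into the box by adding 2md; [bounds] below shows that the
   natural subtraction does not truncate. *)
pose val_ (p : boxm) i :=
  (p.1 i * m + p.2 i + 2 * m * d - z0 i * m)%N.
pose phi (p : boxm) : box := [ffun i => inord (val_ p i)].
pose w (p : boxm) : 'rV[R]_d :=
  m%:R *: (lattice_point p.1 - lattice_point z0) + \row_i (p.2 i)%:R.
have w_le (p : boxm) : p.1 \in lattice_near y -> vnorm k (w p) ^+ 2 <= (2 * m * d)%:R ^+ 2.
  move=> py; apply: le_trans (vnormD_sqr _ _ _) _; rewrite vnormZ_sqr.
  have e_le : vnorm k (\row_i (p.2 i)%:R : 'rV[R]_d) ^+ 2 <= (m * d)%:R ^+ 2.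
    apply: le_trans (vnorm_sqr_le_sum _ _) _.
    rewrite ler_pXn2r ?nnegrE ?sumr_ge0//.
    apply: (@le_trans _ _ (\sum_(i < d) m%:R)).
      by apply: ler_sum => i _; rewrite mxE ger0_norm ?ler0n// ler_nat ltnW.
    by rewrite sumr_const card_ord natrM mulr_natr.
  have z_le : vnorm k (lattice_point p.1 - lattice_point z0) ^+ 2 <= d%:R ^+ 2.
    rewrite (_ : _ - _ = (lattice_point p.1 - y) + (-1) *: (lattice_point z0 - y)).
      apply: le_trans (vnormD_sqr _ _ _) _; rewrite vnormZ_sqr sqrrN expr1n mul1r.
      by move: py z0y; rewrite !inE => /andP[_ h1] /andP[_ h2]; lra.
    by rewrite scaleN1r opprB addrA subrK.
  (* The blown-up difference and the offset contribute 2 (md)^2 each, which accounts for the radius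
     2md of the ball. *)
  rewrite (_ : (2 * m * d)%:R ^+ 2 =
     2 * (m%:R ^+ 2 * d%:R ^+ 2) + 2 * (m * d)%:R ^+ 2 :> R); last first.
    by rewrite !natrM; ring.
  by rewrite lerD// ler_wpM2l// ler_wpM2l// sqr_ge0.
have w_coord p i : w p ord0 i =
    (p.1 i * m + p.2 i)%:R - (z0 i * m)%:R.
  by rewrite !mxE natrD !natrM; ring.
have bounds (p : boxm) i : p.1 \in lattice_near y ->
    (z0 i * m <= p.1 i * m + p.2 i + 2 * m * d)%N /\ (val_ p i < (4 * m * d).+1)%N.
  move=> py; have := le_trans (coord_sqr_le_vnorm k (w p) i) (w_le p py).
  rewrite -[_ ^+ 2](real_normK (num_real _)) ler_pXn2r ?nnegrE// w_coord.
  rewrite ler_norml => /andP[h1 h2].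
  have lo : (z0 i * m <= p.1 i * m + p.2 i + 2 * m * d)%N.
    by rewrite -(ler_nat R) natrD; lra.
  split=> //; rewrite ltnS -(ler_nat R) natrB// natrD.
  have hE : (4 * m * d)%:R = (2 * m * d)%:R + (2 * m * d)%:R :> R.
    by rewrite !natrM; ring.
  by rewrite [leRHS]hE; lra.
have phi_in (p : boxm) : p.1 \in lattice_near y -> phi p \in lattice_ball.
  move=> py; rewrite inE (_ : lattice_point (phi p) = w p) ?w_le//.
  apply/rowP => i; rewrite w_coord mxE ffunE.
  by have [lo hi] := bounds p i py; rewrite inordK// natrB// natrD; ring.
have phi_inj : {in finset.setX (lattice_near y) [set: {ffun 'I_d -> 'I_m}]%SET &, injective phi}.
  move=> [z e] [z' e'] /finset.setXP[/= zy _] /finset.setXP[/= zy' _] /ffunP eq_phi.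
  have eq_val i : (z i * m + e i = z' i * m + e' i)%N.
    have := congr1 val (eq_phi i); rewrite !ffunE /= !inordK//=; first last.
    - by have [] := bounds (z, e) i zy.
    - by have [] := bounds (z', e') i zy'.
    rewrite /val_ /= => h; have [/= lo _] := bounds (z, e) i zy.
    have [/= lo' _] := bounds (z', e') i zy'.
    apply/eqP; rewrite -(eqn_add2r (2 * m * d)); apply/eqP.
    by rewrite -(subnK lo) h subnK.
  have m_gt0 (i : 'I_d) : (0 < m)%N by exact: leq_ltn_trans (leq0n _) (ltn_ord (e i)).
  (* As e i < m, quotient and remainder modulo m recover z i and e i. *)
  congr pair; apply/ffunP => i; apply: val_inj => /=.
    have := congr1 (divn^~ m) (eq_val i).
    by rewrite !divnMDl ?(m_gt0 i)// !divn_small ?addn0.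
  have := congr1 (modn^~ m) (eq_val i).
  by rewrite !modnMDl !modn_small.
have <- : #|finset.setX (lattice_near y) [set: {ffun 'I_d -> 'I_m}]%SET| =
    (#|lattice_near y| * m ^ d)%N.
  by rewrite cardsX cardsT card_ffun !card_ord.
rewrite -(card_in_imset phi_inj); apply: subset_leq_card.
by apply/fintype.subsetP => _ /imsetP[[z e] /finset.setXP[zy _] ->]; exact: (phi_in (z, e)).
Qed.

End lattice_ball.

(** * Counting by bit strings *)

(** Fewer than 2^(L+1) strings have size at most L, and [A] is the union of the fibres of [code]
    over them. *)
Lemma card_le_codes (I : finType) (A : {set I}) (code : I -> seq bool)
    (L K : nat) :
  (forall z, z \in A -> (size (code z) <= L)%N) ->
  (forall s, (#|finset (fun z => (z \in A) && (code z == s))| <= K)%N) ->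
  (#|A| <= 2 ^ L.+1 * K)%N.
Proof.
move=> szA fibre.
(* Strings of size at most L embed into tuples of size L.+1. *)
pose pad s := nseq (L - size s) false ++ true :: s.
pose unpad s := drop (index true s).+1 s.
have padK : cancel pad unpad.
  move=> s; rewrite /unpad /pad index_cat mem_nseq /= andbF /= addn0 size_nseq.
  by rewrite drop_cat size_nseq ltnNge leqnSn /= subSnn /= drop0.
(* The default tuple is never reached on [A], where the padded code has size exactly L + 1. *)
pose c z : L.+1.-tuple bool := insubd [tuple of nseq L.+1 false] (pad (code z)).
have valc z : z \in A -> c z = pad (code z) :> seq bool.
  move=> /szA h; rewrite val_insubd size_cat size_nseq /= addnS subnK//.
  by rewrite eqxx.
rewrite -sum1_card (partition_big c predT)//=.
apply: leq_trans (_ : \sum_(t : L.+1.-tuple bool) K <= _)%N; last first.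
  by rewrite sum_nat_const card_tuple card_bool.
apply: leq_sum => t _; rewrite sum1_card.
apply: leq_trans (fibre (unpad t)); apply: subset_leq_card.
apply/fintype.subsetP => z; rewrite !inE => /andP[zA /eqP <-].
by rewrite zA /= valc// padK.
Qed.

(** * Expected counts, Markov's inequality and generated events *)

Section probability_bounds.
Context {dT : measure_display} {T : measurableType dT} {R : realType}.
Variable P : probability T R.

(** The sum is the expected number of events that occur, and this number is at most [C] at every
    outcome. *)
Lemma sum_probability_le (I : finType) (G : {set I}) (H : I -> set T) (C : R) :
  (forall i, i \in G -> measurable (H i)) ->
  (forall w, #|finset (fun i => (i \in G) && (w \in H i))|%:R <= C) ->
  (\sum_(i in G) P (H i) <= C%:E)%E.
Proof.
move=> mH cntH; pose H' i := if i \in G then H i else set0.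
have mH' i : measurable (H' i) by rewrite /H'; case: ifP => // /mH.
rewrite big_mkcond /=.
rewrite (eq_bigr (fun i => \int[P]_w (\1_(H' i) w)%:E)%E); last first.
  move=> i _; rewrite integral_indic// setIT /H'.
  by case: ifP => // _; rewrite measure0.
rewrite -ge0_integral_sum//; last first.
  by move=> i; apply/measurable_EFinP; exact: measurable_indic.
rewrite -[leRHS]mule1 -(@probability_setT _ _ _ P) -integral_cst//.
apply: ge0_le_integral => //.
- by move=> w _; apply: sume_ge0 => i _; rewrite lee_fin.
- by apply: emeasurable_sum => i; apply/measurable_EFinP; exact: measurable_indic.
- move=> w _ /=; rewrite sumEFin lee_fin; apply: le_trans (cntH w).
  rewrite -sum1_card natr_sum [leRHS]big_mkcond /= ler_sum// => i _.
  rewrite indicE /H' finset.in_set; case: ifP => _ /=.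
    by case: (w \in H i).
  by rewrite in_set0.
Qed.

Lemma markov_real (f : T -> R) (a : R) :
  measurable_fun setT f -> (forall w, 0 <= f w) -> 0 < a ->
  (a%:E * P [set w | (a <= f w)%R] <= \int[P]_w (f w)%:E)%E.
Proof.
move=> mf f0 a0.
have mf' : measurable_fun setT (fun w => (f w)%:E) by exact/measurable_EFinP.
have := le_integral_abse P measurableT mf' a0.
rewrite setTI; under eq_set do rewrite lee_fin ger0_norm//.
by under eq_integral do rewrite /= ger0_norm//.
Qed.

End probability_bounds.

(** The preimages under [h] of measurable sets form a sigma-algebra that contains the generators of
    [gen_row]. With [h] the coin or a constant map, this describes the events of each machine. *)
Lemma gen_row_factor {dT dV} {T : measurableType dT} {V : measurableType dV}
    {R : realType} {n d : nat} (X : T -> 'M[R]_(n, d)) (v : 'I_n)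
    (h : T -> V) (phi : 'I_d -> V -> R) (A : set T) :
  (forall i, measurable_fun setT (phi i)) ->
  (forall w i, X w v i = phi i (h w)) ->
  gen_row X v A -> exists C, measurable C /\ A = h @^-1` C.
Proof.
move=> mphi Xphi; rewrite /gen_row => gA.
have : preimage_set_system setT h measurable A.
  move: A gA; apply: smallest_sub.
    by apply: sigma_algebra_preimage; exact: sigma_algebra_measurable.
  move=> _ [i [B [mB ->]]]; exists (phi i @^-1` B).
    by rewrite -[X in measurable X]setTI; exact: mphi.
  by rewrite setTI; apply/seteqP; split=> w /=; rewrite Xphi.
by move=> [C mC <-]; exists C; rewrite setTI.
Qed.

(** * The hard input distribution *)

Section hidden_input.
Context {dU : measure_display} {U : measurableType dU} {R : realType}.
Variable rho : probability U R.

(** The shared random string together with an independent coin; [true], of probability 9/10, means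
    that the gradient is hidden. *)
Definition coin_prob : set (U * bool) -> \bar R :=
  (rho \x bernoulli_prob (9 / 10 : R))%E.

HB.instance Definition _ := Measure.on coin_prob.

Let coin_setX (A : set U) (C : set bool) : measurable A ->
  coin_prob (A `*` C) = (rho A * bernoulli_prob (9 / 10 : R) C)%E.
Proof. by move=> mA; rewrite /coin_prob product_measure1E. Qed.

Let coin_setT : coin_prob setT = 1%E.
Proof.
by rewrite -setXTT coin_setX// !probability_setT mule1.
Qed.

HB.instance Definition _ :=
  Measure_isProbability.Build _ _ _ coin_prob coin_setT.

Let P : probability (U * bool)%type R := coin_prob.

Lemma coin_prob_fst (A : set U) : measurable A -> P (fst @^-1` A) = rho A.
Proof.
move=> mA; rewrite -[fst @^-1` A](_ : A `*` setT = _).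
  by rewrite [LHS]coin_setX// probability_setT mule1.
by apply/seteqP; split=> -[u c] //= -[].
Qed.

Lemma coin_prob_snd (C : set bool) :
  P (snd @^-1` C) = bernoulli_prob (9 / 10 : R) C.
Proof.
rewrite -[snd @^-1` C](_ : setT `*` C = _).
  by rewrite [LHS]coin_setX// probability_setT mul1e.
by apply/seteqP; split=> -[u c] //= -[].
Qed.

Let p01 : 0 <= 9 / 10 :> R /\ 9 / 10 <= 1 :> R.
Proof. by split; lra. Qed.

Lemma coin_prob_true : P (snd @^-1` [set true]) = (9 / 10)%:E.
Proof.
rewrite coin_prob_snd bernoulli_probE; last by case: p01 => -> ->.
by rewrite !diracE mem_set// memNset// mule1 mule0 adde0.
Qed.

Lemma coin_prob_false : P (snd @^-1` [set false]) = (1 / 10)%:E.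
Proof.
rewrite coin_prob_snd bernoulli_probE; last by case: p01 => -> ->.
rewrite !diracE memNset// mem_set// mule1 mule0 add0e; congr EFin.
by rewrite /unstable.onem; lra.
Qed.

Lemma measurable_coin (phi : bool -> R) :
  measurable_fun setT (fun w : U * bool => phi w.2).
Proof. by apply: measurableT_comp => //; exact: measurable_snd. Qed.

Let coin_decomp (phi : bool -> R) : (fun w : U * bool => (phi w.2)%:E) =
  (fun w => (phi true)%:E * (\1_(snd @^-1` [set true]) w)%:E +
            (phi false)%:E * (\1_(snd @^-1` [set false]) w)%:E)%E.
Proof.
apply/funext => -[u c]; rewrite !indicE; case: c => /=.
  by rewrite mem_set// memNset// mule1 mule0 adde0.
by rewrite memNset// mem_set// mule1 mule0 add0e.
Qed.

Let measurable_coin_set (c : bool) :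
  measurable (snd @^-1` [set c] : set (U * bool)).
Proof. by rewrite -[X in measurable X]setTI; exact: measurable_snd. Qed.

Lemma integrable_coin (phi : bool -> R) :
  P.-integrable setT (fun w => (phi w.2)%:E).
Proof.
rewrite coin_decomp; apply: integrableD => //.
  by apply: integrableZl => //; exact: integrable_indic.
by apply: integrableZl => //; exact: integrable_indic.
Qed.

Lemma integral_coin (phi : bool -> R) :
  (\int[P]_w (phi w.2)%:E = (9 / 10 * phi true + 1 / 10 * phi false)%:E)%E.
Proof.
rewrite coin_decomp integralD//; last 2 first.
- by apply: integrableZl => //; exact: integrable_indic.
- by apply: integrableZl => //; exact: integrable_indic.
rewrite !integralZl//; try exact: integrable_indic.
rewrite !integral_indic// !setIT.
rewrite [X in (_ * X + _)%E]coin_prob_true [X in (_ + _ * X)%E]coin_prob_false.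
by rewrite -!EFinM -EFinD ![phi _ * _]mulrC.
Qed.

(* Machine v0 sees 0 with probability 9/10; the value 10 * grad otherwise
   keeps its input unbiased. *)
Definition hidden_input {n d : nat} (v0 : 'I_n) (grad : 'rV[R]_d)
    (w : U * bool) : 'M[R]_(n, d) :=
  \matrix_(v, i) (if v == v0 then if w.2 then 0 else 10 * grad ord0 i
                  else grad ord0 i).

(** The input of [v0] deviates by -grad with probability 9/10 and by 9 grad with probability 1/10.
    The mean deviation is zero and the second moment is (9/10 + 81/10) |grad|^2 = 9 |grad|^2; all
    other inputs are exact. *)
Lemma valid_hidden_input {n d : nat} (k : norm_kind) (sigma : R)
    (v0 : 'I_n) (grad : 'rV[R]_d) :
  9 * vnorm k grad ^+ 2 <= sigma ^+ 2 ->
  valid_input k sigma P (hidden_input v0 grad) grad.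
Proof.
move=> grad_le.
pose phi v i (c : bool) := if v == v0 then if c then 0 else 10 * grad ord0 i
                  else grad ord0 i.
have XE v i : (fun w : U * bool => hidden_input v0 grad w v i) =
    (fun w => phi v i w.2) by apply/funext => w; rewrite mxE.
split; [|split].
- by move=> v i; rewrite XE; exact: measurable_coin.
- move=> v i; split.
    under eq_fun do rewrite mxE.
    exact: (integrable_coin (phi v i)).
  under eq_integral do rewrite mxE.
  rewrite (integral_coin (phi v i)) /phi; case: ifP => _; congr EFin; lra.
- move=> v.
  pose psi (c : bool) : R :=
    if v == v0 then (if c then 1 else 81) * vnorm k grad ^+ 2 else 0.
  rewrite (eq_integral (fun w => (psi w.2)%:E)).
    rewrite integral_coin lee_fin /psi; case: ifP => _.
      by apply: le_trans grad_le; lra.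
    by rewrite !mulr0 addr0 sqr_ge0.
  move=> [u c] _; congr EFin; rewrite /psi /=.
  have rowE : row v (hidden_input v0 grad (u, c)) - grad =
      (if v == v0 then if c then -1 else 9 else 0) *: grad.
    by apply/rowP => i; rewrite !mxE /=; case: ifP => _; [case: c|]; ring.
  rewrite {}rowE vnormZ_sqr; case: ifP => _; [case: c|]; ring.
Qed.

(** The row of [v0] depends on the coin only and the string is the other factor of a product
    measure. The remaining rows are constant, so their events are empty or full: one empty event
    makes both sides zero, full ones contribute factors 1. *)
Lemma hidden_input_indep {n d : nat} (v0 : 'I_n) (grad : 'rV[R]_d) :
  mutually_indep P (hidden_input v0 grad) fst.
Proof.
move=> A FA.
have [B [mB AN]] := FA None.
have [C AS] : exists C, A (Some v0) = snd @^-1` C.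
  have [] := gen_row_factor (hidden_input v0 grad) v0 snd
    (fun i (c : bool) => if c then 0 else 10 * grad ord0 i) _ _ _ (FA (Some v0)) => //.
    by move=> w i; rewrite mxE eqxx.
  by move=> C [_ ->]; exists C.
have Atriv v : v != v0 -> A (Some v) = set0 \/ A (Some v) = setT.
  move=> vv0.
  have [] := gen_row_factor (hidden_input v0 grad) v (fun=> tt)
    (fun i (c : unit) => grad ord0 i) _ _ _ (FA (Some v)) => //.
    by move=> w i; rewrite mxE (negbTE vv0).
  move=> D [_ ->]; have [Dtt|Dtt] := pselect (D tt); [right|left].
    by apply/seteqP; split.
  by apply/seteqP; split.
have [[v [vv0 Av0]]|Aall] := pselect (exists v, v != v0 /\ A (Some v) = set0).
  rewrite (bigD1 (Some v))//= Av0 measure0 /= mul0r.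
  rewrite (_ : \bigcap_j A j = set0) ?measure0//.
  by apply/seteqP; split=> // w /(_ (Some v) I); rewrite Av0.
have AT v : v != v0 -> A (Some v) = setT.
  by move=> vv0; have [Av|//] := Atriv v vv0; case: Aall; exists v.
rewrite (bigD1 None)//= (bigD1 (Some v0))//= big1; last first.
  move=> [v|]//= vv0; rewrite AT ?probability_setT//.
rewrite mulr1 AN AS coin_prob_fst// coin_prob_snd -fineM ?fin_num_measure//.
rewrite -coin_setX//; congr (fine (coin_prob _)).
apply/seteqP; split=> [w Aw|w [Bw Cw] j _].
  by split; [have := Aw None I; rewrite AN|have := Aw (Some v0) I; rewrite AS].
case: j => [v|]; last by rewrite AN.
by have [->|vv0] := eqVneq v v0; [rewrite AS|rewrite AT].
Qed.

Lemma coin_has_law : has_law P fst rho.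
Proof. by split; [exact: measurable_fst|move=> B mB; exact: coin_prob_fst]. Qed.

End hidden_input.

(** * Averaging over the candidate gradients *)

(** The bound on m^d lets the outputs reachable with at most L bits come close to no more than a
    tenth of the candidates; the bound on b lets Markov's inequality give probability at most 2/3 to
    receiving more than L bits. *)
Lemma exists_hard_gradient {R : realType} (k : norm_kind) (n d m L : nat)
    (sigma b : R) (v0 : 'I_n) {dU} {U : measurableType dU}
    (rho : probability U R)
    (g : 'I_n -> U -> 'M[R]_(n, d) -> seq bool)
    (f : 'I_n -> 'rV[R]_d -> U -> seq bool -> 'rV[R]_d) :
  (0 < d)%N -> (0 < m)%N -> 0 < sigma ->
  (10 * 2 ^ L.+1 <= m ^ d)%N -> 3 * b <= 2 * L.+1%:R ->
  VR_algorithm k sigma b rho g f ->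
  exists grad : 'rV[R]_d, 9 * vnorm k grad ^+ 2 <= sigma ^+ 2 /\
    ((2 / 15 * (sigma / (12 * m%:R)) ^+ 2)%:E <=
     \int[coin_prob rho]_w
       ((vnorm k (out g f v0 w.1 (hidden_input v0 grad w) - grad)) ^+ 2)%:E)%E.
Proof.
move=> d0 m0 s0 mL bL [_ VR].
have mR : 0 < m%:R :> R by rewrite ltr0n.
have dR : 0 < d%:R :> R by rewrite ltr0n.
pose P : probability (U * bool)%type R := coin_prob rho.
(* This mesh turns the lattice radius 2md into sigma/3, and the near radius d/2 into [r]. *)
pose delta := sigma / (6 * m%:R * d%:R).
have delta0 : 0 < delta by rewrite divr_gt0// !mulr_gt0.
pose G := @lattice_ball R k d m.
pose gr z : 'rV[R]_d := delta *: lattice_point d m z.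
pose r := sigma / (12 * m%:R).
have rE : r = delta * (d%:R / 2) by rewrite /r /delta; field; rewrite !gt_eqF.
have r0 : 0 < r by rewrite divr_gt0// mulr_gt0.
pose X z := @hidden_input _ U _ n d v0 (gr z).
pose err z w := vnorm k (out g f v0 w.1 (X z w) - gr z) ^+ 2.
have gr_le z : z \in G -> 9 * vnorm k (gr z) ^+ 2 <= sigma ^+ 2.
  rewrite inE vnormZ_sqr => /(ler_wpM2l (sqr_ge0 delta)) h.
  suff <- : 9 * (delta ^+ 2 * (2 * m * d)%:R ^+ 2) = sigma ^+ 2.
    by rewrite ler_wpM2l.
  by rewrite !natrM /delta; field; rewrite !gt_eqF.
have algP z (zG : z \in G) := VR _ _ _ P (X z) fst
  (valid_hidden_input rho k sigma v0 (gr z) (gr_le z zG))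
  (hidden_input_indep rho v0 (gr z)) (coin_has_law rho).
have merr z : z \in G -> measurable_fun setT (err z).
  move=> /algP[mout _]; apply: measurable_vnorm_sqr => i.
  by under eq_fun do rewrite !mxE; apply: measurable_funB => //; exact: mout.
pose sz z (w : U * bool) : R := (size (g v0 w.1 (X z w)))%:R.
(* The favourable event for the algorithm: the gradient is hidden, few bits arrive, and the estimate
   is still within [r]. *)
pose H z := [set w | w.2 = true] `&`
   ([set w | sz z w <= L%:R] `&` [set w | err z w < r ^+ 2]).
have mtrue : measurable [set w : U * bool | w.2 = true].
  rewrite -[X in measurable X]setTI.
  exact: (@measurable_snd _ _ U bool measurableT [set true]).
have mH z : z \in G -> measurable (H z).
  move=> zG; have [_ [msz _]] := algP z zG.
  apply: measurableI => //; apply: measurableI.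
    rewrite -[X in measurable X]setTI.
    by apply: measurable_fun_le => //; exact: msz.
  rewrite (_ : [set w | _] = ~` [set w | r ^+ 2 <= err z w]).
    apply: measurableC; rewrite -[X in measurable X]setTI.
    by apply: measurable_fun_le => //; exact: merr.
  by apply/funext => w /=; apply/propext; rewrite ltNge; split=> /negP.
have countH w :
    #|finset (fun z => (z \in G) && (w \in H z))|%:R <= (#|G|%:R / 10 : R).
  rewrite ler_pdivlMr// -natrM ler_nat.
  set A := finset _.
  have : (#|A| * m ^ d <= 2 ^ L.+1 * #|G|)%N.
    have md0 : (0 < m ^ d)%N by rewrite expn_gt0 m0.
    apply: leq_trans (_ : 2 ^ L.+1 * (#|G| %/ m ^ d) * m ^ d <= _)%N.
      rewrite leq_pmul2r//; apply: (card_le_codes _ _ (fun z => g v0 w.1 (X z w))).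
        move=> z; rewrite inE => /andP[_]; rewrite inE => -[_ [+ _]] /=.
        by rewrite /mkset /sz ler_nat.
      move=> s; rewrite leq_divRL//.
      (* With the gradient hidden, [v0] sees 0, so the string [s] fixes its output for all
         candidates; dividing by [delta] gives the centre of a small lattice ball. *)
      apply: leq_trans (card_lattice_near k d m (delta^-1 *: f v0 0 w.1 s)).
      rewrite leq_pmul2r//; apply: subset_leq_card; apply/fintype.subsetP => z.
      rewrite !inE => /andP[/andP[zG]].
      rewrite zG inE => -[/= wt [_ errz]] /eqP gs.
      have row0 : row v0 (X z w) = 0 by apply/rowP => i; rewrite !mxE eqxx wt.
      move: errz; rewrite /err /out row0 gs rE => errz.
      rewrite (_ : _ - _ = (- delta^-1) *: (f v0 0 w.1 s - gr z)); last first.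
        by rewrite scalerBr !scaleNr opprK scalerA mulVf ?gt_eqF// scale1r addrC.
      rewrite vnormZ_sqr sqrrN exprVn mulrCA mulrC ltr_pdivrMr ?exprn_gt0//.
      by move: errz; rewrite exprMn exprMn exprVn => h; lra.
    by rewrite -mulnA leq_mul2l leq_trunc_div orbT.
  move=> /(leq_trans (leq_mul (leqnn _) mL)).
  by rewrite mulnA [leqRHS]mulnC leq_pmul2r// expn_gt0.
(* Otherwise the probabilities would sum to more than |G|/10; the strict inequality uses that [G] is
   nonempty. *)
have [z zG Hz] : exists2 z, z \in G & fine (P (H z)) <= 1 / 10.
  apply: contrapT => noz.
  have big z : z \in G -> 1 / 10 < fine (P (H z)).
    by move=> zG; rewrite ltNge; apply/negP => h; apply: noz; exists z.
  have := sum_probability_le P _ G H _ mH countH.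
  rewrite (eq_bigr (fun z => (fine (P (H z)))%:E)); last first.
    by move=> z zG; rewrite fineK// fin_num_measure//; exact: mH.
  rewrite sumEFin lee_fin leNgt => /negP; apply.
  have /card_gt0P[z0 z0G] := @lattice_ball_gt0 R k d m.
  rewrite mulrC mulr_natr -sumr_const (bigD1 z0)//= [ltRHS](bigD1 z0)//=.
  rewrite ltr_leD//; first by have := big _ z0G; rewrite div1r.
  by apply: ler_sum => z /andP[zG _]; have := big _ zG; rewrite div1r => /ltW.
exists (gr z); split; first exact: gr_le.
have [_ [msz [_ Esz]]] := algP z zG.
pose S := [set w | (L.+1)%:R <= sz z w].
pose E := [set w | r ^+ 2 <= err z w].
have mS : measurable S.
  rewrite -[X in measurable X]setTI.
  by apply: measurable_fun_le => //; exact: msz.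
have mE : measurable E.
  rewrite -[X in measurable X]setTI.
  by apply: measurable_fun_le => //; exact: merr.
have PS : fine (P S) <= 2 / 3.
  have := markov_real P (sz z) (L.+1)%:R (msz v0)
    (fun w => ler0n _ _) (ltr0Sn _ _).
  move=> /le_trans/(_ (Esz v0)); rewrite -[P _]fineK ?fin_num_measure//.
  rewrite -EFinM lee_fin -/S => h.
  have L0 : 0 < (L.+1)%:R :> R by [].
  by rewrite -(ler_pM2l L0); lra.
(* A hidden gradient forces more than L bits, the event [H z], or a large error, and 9/10 - 2/3 -
   1/10 = 2/15. *)
have PE : 2 / 15 <= fine (P E).
  have sub : [set w | w.2 = true] `<=` S `|` (H z `|` E).
    move=> w wt; have [|szw] := leP (L.+1)%:R (sz z w); first by left.
    right; have [|errw] := leP (r ^+ 2) (err z w); first by right.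
    by left; split=> //; split=> //=; move: szw; rewrite /sz ltr_nat ler_nat ltnS.
  have : (P [set w | w.2 = true] <= P S + (P (H z) + P E))%E.
    apply: (@le_trans _ _ (P (S `|` (H z `|` E)))).
      apply: le_measure => //; rewrite inE//.
      by do ?apply: measurableU => //; exact: mH.
    apply: (le_trans (measureU2 _ _ _)) => //.
      by apply: measurableU => //; exact: mH.
    by rewrite leeD2l// measureU2//; exact: mH.
  have -> : P [set w | w.2 = true] = (9 / 10)%:E by exact: coin_prob_true.
  rewrite -[P S]fineK ?fin_num_measure//.
  rewrite -[P (H z)]fineK ?fin_num_measure//; last exact: mH.
  rewrite -[P E]fineK ?fin_num_measure// -!EFinD lee_fin => h.
  by move: PS Hz h; lra.
apply: le_trans (markov_real P (err z) (r ^+ 2) (merr z zG) _ _).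
- rewrite -[P _]fineK ?fin_num_measure// -EFinM lee_fin mulrC.
  by rewrite ler_wpM2l// sqr_ge0.
- by move=> w; exact: sqr_ge0.
- by rewrite exprn_gt0.
Qed.

(** * Choice of the parameters and conclusion *)

Theorem theorem8 (R : realType) :
  exists c : R, 0 < c /\
  forall (k : norm_kind) (n d : nat) (sigma b : R),
    (0 < n)%N -> (0 < d)%N -> 0 < sigma -> 0 <= b ->
  forall dU (U : measurableType dU) (rho : probability U R)
         (g : 'I_n -> U -> 'M[R]_(n, d) -> seq bool)
         (f : 'I_n -> 'rV[R]_d -> U -> seq bool -> 'rV[R]_d),
    VR_algorithm k sigma b rho g f ->
    exists (grad : 'rV[R]_d) dT (T : measurableType dT) (P : probability T R)
           (X : T -> 'M[R]_(n, d)) (S : T -> U),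
      valid_input k sigma P X grad /\ mutually_indep P X S /\ has_law P S rho /\
      forall v : 'I_n,
        ((c * sigma ^+ 2 * 2 `^ (- (3 * b / d%:R)))%:E
          <= \int[P]_w ((vnorm k (out g f v (S w) (X w) - grad)) ^+ 2)%:E)%E.
Proof.
(* Here 252 = 12 * 21: the error radius is sigma/(12m), and m <= 21a below. *)
exists (2 / 15 / 252 ^+ 2); split; first by rewrite divr_gt0// exprn_gt0.
move=> k n d sigma b n0 d0 s0 b0 dU U rho g f VR.
have dR : 0 < d%:R :> R by rewrite ltr0n.
pose v0 := Ordinal n0; pose L := Num.trunc (3 * b / 2).
(* Chosen so that a^d = 2^(3b/2) bounds 2^L, while a^(-2) is the factor 2^(-3b/d) of the claim. *)
pose a : R := 2 `^ (3 * b / (2 * d%:R)).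
have a1 : 1 <= a.
  by rewrite -(powRr0 2) ler_powR ?ler1n// divr_ge0// mulr_ge0.
have a0 : 0 < a by exact: lt_le_trans a1.
(* The factor 20 absorbs 10 * 2 in 10 * 2^(L+1), as 20 <= 20^d; rounding up costs at most 1 <= a. *)
pose m := (Num.trunc (20 * a)).+1.
have /andP[mlo mhi] : 20 * a <= m%:R <= 21 * a.
  have /andP[h1 h2] := @truncn_itv R (20 * a) (mulr_ge0 (ler0n _ _) (ltW a0)).
  by rewrite /m (ltW h2) -natr1 /=; lra.
have /andP[Llo Lhi] : L%:R <= 3 * b / 2 < L.+1%:R.
  by apply: truncn_itv; rewrite divr_ge0// mulr_ge0.
have mL : (10 * 2 ^ L.+1 <= m ^ d)%N.
  rewrite -(ler_nat R) natrM !natrX exprS.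
  have aL : 2 ^+ L <= a ^+ d.
    rewrite -!powR_mulrn ?(ltW a0)// -powRrM ler_powR ?ler1n//.
    suff -> : 3 * b / (2 * d%:R) * d%:R = 3 * b / 2 :> R by [].
    by field; rewrite gt_eqF.
  apply: (@le_trans _ _ ((20 * a) ^+ d)); last first.
    by apply: lerXn2r => //; rewrite nnegrE; lra.
  rewrite exprMn mulrA ler_pM ?mulr_ge0 ?exprn_ge0//.
  rewrite (_ : 10 * 2 = 20 :> R); last by lra.
  case: d d0 {dR a a1 a0 m mlo mhi g f VR aL} => // d _.
  by rewrite exprS ler_peMr// exprn_ege1// ler1n.
have bL : 3 * b <= 2 * L.+1%:R by lra.
have [grad [grad_le err_ge]] := exists_hard_gradient k n d m L sigma b v0 rho g f
  d0 isT s0 mL bL VR.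
exists grad, _, (U * bool)%type, (coin_prob rho), (hidden_input v0 grad), fst.
split; first exact: valid_hidden_input.
split; first exact: hidden_input_indep.
split; first exact: coin_has_law.
(* All machines output the same vector, so the bound for [v0] passes to every [v]. *)
move=> v; under eq_integral do rewrite (VR.1 v v0).
apply: le_trans err_ge; rewrite lee_fin.
have -> : 2 `^ (- (3 * b / d%:R)) = (a ^+ 2)^-1.
  rewrite powRN -powR_mulrn ?(ltW a0)// -powRrM; congr (_ `^ _)^-1.
  by field; rewrite gt_eqF.
have mR : 0 < m%:R :> R by [].
rewrite (_ : _ * (a ^+ 2)^-1 = 2 / 15 * (sigma / (252 * a)) ^+ 2); last first.
  by field; rewrite gt_eqF.
rewrite ler_wpM2l ?divr_ge0//; apply: lerXn2r.
- by rewrite nnegrE divr_ge0 ?mulr_ge0 ?(ltW s0) ?(ltW a0).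
- by rewrite nnegrE divr_ge0 ?mulr_ge0 ?(ltW s0) ?(ltW mR).
- by rewrite ler_wpM2l ?(ltW s0)// lef_pV2 ?posrE ?mulr_gt0//; lra.
Qed.
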